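(* Let $\mathscr A:(\Omega,\mathscr F,\mathbb P)\to\mathbb R^{n\times n}$ be a random covariance matrix with $\mathbb E\|\mathscr A\|_1<+\infty$. 1. $\hat{\mathbf A}\succeq\mathbf 0$ is a (Wasserstein) barycenter of $\mathscr A$ if and only if $\hat{\mathbf A}=(\mathbb E\mathscr G)(\mathbb E\mathscr G)^*$ for some optimal random Green's matrix $\mathscr G\in\mathcal G(\mathscr A)$. Consequently, if an optimal random Green's matrix does not exist, neither does a barycenter. 2. Any optimal random Green's matrix is properly aligned.
   Context: $\|\cdot\|_1$ and $\|\cdot\|_2$ are the trace (nuclear) norm and the Hilbert–Schmidt (Frobenius) norm; $^*$ is the transpose; $\succeq\mathbf 0$ means symmetric positive semidefinite (s.p.d.). A random covariance matrix is a random matrix on a probability space with $\mathscr A(\omega)\succeq\mathbf 0$ for every $\omega$. $\mathcal W_2^2(\mathbf A,\mathbf B)=\operatorname{tr}\mathbf A+\operatorname{tr}\mathbf B-2\operatorname{tr}(\mathbf A^{1/2}\mathbf B\mathbf A^{1/2})^{1/2}$. A barycenter of $\mathscr A$ is an s.p.d. matrix $\hat{\mathbf A}$ with $\mathbb E\,\mathcal W_2^2(\hat{\mathbf A},\mathscr A)=\inf_{\mathbf B\succeq\mathbf 0}\mathbb E\,\mathcal W_2^2(\mathbf B,\mathscr A)$. A random Green's matrix of $\mathscr A$, written $\mathscr G\in\mathcal G(\mathscr A)$, is a random matrix $\mathscr G:(\Omega,\mathscr F,\mathbb P)\to\mathbb R^{n\times n}$ with $\mathscr G(\omega)\mathscr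 G(\omega)^*=\mathscr A(\omega)$ $\mathbb P$-a.s. (its expectation is then well defined). It is properly aligned if $(\mathbb E\mathscr G)^*\mathscr G(\omega)\succeq\mathbf 0$ $\mathbb P$-a.s., and optimal if $\|\mathbb E\mathscr G\|_2=\max_{\mathscr S\in\mathcal G(\mathscr A)}\|\mathbb E\mathscr S\|_2$. *)

(* Defs.v *)
From mathcomp Require Export all_boot all_order all_algebra.
From mathcomp Require Export all_classical all_reals all_analysis.

Set Implicit Arguments.
Unset Strict Implicit.
Unset Printing Implicit Defensive.

Import Order.TTheory GRing.Theory Num.Theory.

Local Open Scope classical_set_scope.
Local Open Scope ring_scope.

Section Matrices.
Context {R : realType} {n : nat}.
Implicit Types A B : 'M[R]_n.

(* Symmetry is part of the definition, not a consequence of the sign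
   condition on the quadratic form. *)
Definition spd A : Prop :=
  A^T = A /\ forall x : 'cV[R]_n, 0 <= (x^T *m A *m x) 0 0.

(* An s.p.d. matrix has exactly one s.p.d. square root, so the choice made by
   xget is forced on s.p.d. arguments; it is only ever applied to those. *)
Definition sqrtmx A : 'M[R]_n := xget 0 [set B | spd B /\ B *m B = A].

(* The sum of the singular values of A, i.e. the trace of |A|. *)
Definition trace_norm A : R := \tr (sqrtmx (A^T *m A)).

Definition HS_norm A : R := Num.sqrt (\sum_i \sum_j A i j ^+ 2).

Definition W2sq A B : R :=
  \tr A + \tr B - 2 * \tr (sqrtmx (sqrtmx A *m B *m sqrtmx A)).

End Matrices.

Section RandomMatrices.
Context {d : measure_display} {Omega : measurableType d} {R : realType}.
Context {n : nat} (P : probability Omega R).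
Implicit Types A G S : Omega -> 'M[R]_n.

(* Entrywise measurability, which is Borel measurability for the topology of
   the finite-dimensional space of n x n matrices. *)
Definition random_matrix G : Prop :=
  forall i j, measurable_fun [set: Omega] (fun w => G w i j).

Definition random_covariance A : Prop :=
  random_matrix A /\ forall w, spd (A w).

(* Entrywise expectation; fine loses nothing when the entries are integrable,
   as they are for the Green's matrices of an A with E tr A finite. *)
Definition mx_expectation G : 'M[R]_n :=
  \matrix_(i, j) fine ('E_P[fun w => G w i j])%E.

Definition green A G : Prop :=
  random_matrix G /\ {ae P, forall w, G w *m (G w)^T = A w}.

Definition properly_aligned G : Prop :=
  {ae P, forall w, spd ((mx_expectation G)^T *m G w)}.

Definition optimal_green A G : Prop :=
  green A G /\
  forall S, green A S ->
    HS_norm (mx_expectation S) <= HS_norm (mx_expectation G).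

Definition barycenter_cost A (B : 'M[R]_n) : \bar R :=
  ('E_P[fun w => W2sq B (A w)])%E.

Definition barycenter A (Ahat : 'M[R]_n) : Prop :=
  spd Ahat /\
  barycenter_cost A Ahat =
    ereal_inf [set barycenter_cost A B | B in [set B | spd B]].

End RandomMatrices.

(* Main.v *)
Require Import Defs.
From mathcomp Require Import all_boot all_order all_algebra.
From mathcomp Require Import all_classical all_reals all_analysis.
From mathcomp Require Import measurable_realfun ring lra.

(* For B psd and G a Green's matrix of A, every C with C C^T = B satisfies
   tr (C^T G) <= tr (B^{1/2} A B^{1/2})^{1/2}, with equality only if C^T G is
   psd. Equality is attained for C = B^{1/2} by a Green's matrix that is a Borel
   function of A; let g_B be its mean. Completing the square gives
   E W_2^2(B, A) = E tr A - |g_B|^2 + |B^{1/2} - g_B|^2, whereas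
   E W_2^2(g g^T, A) <= E tr A - |g|^2 for the mean g of any Green's matrix.
   So minimizing the cost over B amounts to maximizing |g|, and optimality of G
   forces equality in the first inequality almost surely.
   Square roots and generalized inverses are obtained as limits of explicit
   monotone iterations, which yields their measurability along the way. *)

Set Implicit Arguments.
Unset Strict Implicit.
Unset Printing Implicit Defensive.

Import Order.TTheory GRing.Theory Num.Theory.
Import numFieldNormedType.Exports.

Local Open Scope classical_set_scope.
Local Open Scope ring_scope.

(** * Positive semidefinite matrices, traces and quadratic forms *)

Section PositiveSemidefinite.
Context {R : realType} {n : nat}.
Implicit Types (A B M T X Y : 'M[R]_n) (x : 'cV[R]_n).

Lemma addmxE m p (X Y : 'M[R]_(m, p)) i j : (X + Y) i j = X i j + Y i j.
Proof. by rewrite mxE. Qed.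

Lemma oppmxE m p (X : 'M[R]_(m, p)) i j : (- X) i j = - X i j.
Proof. by rewrite mxE. Qed.

Lemma scalemxE m p c (X : 'M[R]_(m, p)) i j : (c *: X) i j = c * X i j.
Proof. by rewrite mxE. Qed.

Definition mxlinE := (addmxE, oppmxE, scalemxE).

Lemma trmxZ m p c (X : 'M[R]_(m, p)) : (c *: X)^T = c *: X^T.
Proof. exact: linearZ. Qed.

Lemma trmxD m p (X Y : 'M[R]_(m, p)) : (X + Y)^T = X^T + Y^T.
Proof. exact: raddfD. Qed.

Lemma trmxN m p (X : 'M[R]_(m, p)) : (- X)^T = - X^T.
Proof. exact: raddfN. Qed.

Definition qform A x : R := (x^T *m A *m x) 0 0.

Lemma qformD A B x : qform (A + B) x = qform A x + qform B x.
Proof. by rewrite /qform mulmxDr mulmxDl mxE. Qed.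

Lemma qformN A x : qform (- A) x = - qform A x.
Proof. by rewrite /qform mulmxN mulNmx mxE. Qed.

Lemma qformB A B x : qform (A - B) x = qform A x - qform B x.
Proof. by rewrite qformD qformN. Qed.

Lemma qformZ c A x : qform (c *: A) x = c * qform A x.
Proof. by rewrite /qform -scalemxAr -scalemxAl mxE. Qed.

Lemma qformE A x : qform A x = \sum_i \sum_j A i j * (x i 0 * x j 0).
Proof.
rewrite /qform -mulmxA mxE; apply: eq_bigr => i _.
rewrite !mxE mulr_sumr; apply: eq_bigr => j _; ring.
Qed.

Lemma spdD A B : spd A -> spd B -> spd (A + B).
Proof.
move=> [sA pA] [sB pB]; split=> [|x]; first by rewrite linearD /= sA sB.
by rewrite -/(qform _ _) qformD addr_ge0//; [exact: pA | exact: pB].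
Qed.

Lemma spdZ c A : 0 <= c -> spd A -> spd (c *: A).
Proof.
move=> c0 [sA pA]; split=> [|x]; first by rewrite linearZ /= sA.
by rewrite -/(qform _ _) qformZ mulr_ge0//; exact: pA.
Qed.

Lemma spd_congr X A : spd A -> spd (X *m A *m X^T).
Proof.
move=> [sA pA]; split=> [|x]; first by rewrite !trmx_mul trmxK sA mulmxA.
by have := pA (X^T *m x); rewrite trmx_mul trmxK !mulmxA.
Qed.

Lemma spd_congr_sym X A : X^T = X -> spd A -> spd (X *m A *m X).
Proof. by move=> sX /(spd_congr X); rewrite sX. Qed.

Lemma spd1 : spd (1%:M : 'M[R]_n).
Proof.
split=> [|x]; first by rewrite trmx1.
rewrite mulmx1 mxE; apply: sumr_ge0 => i _.
by rewrite mxE -expr2 sqr_ge0.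
Qed.

Lemma spd_mul_tr X : spd (X *m X^T).
Proof. by have := spd_congr X spd1; rewrite mulmx1. Qed.

Lemma spd_tr_mul X : spd (X^T *m X).
Proof. by have := spd_mul_tr X^T; rewrite trmxK. Qed.

Lemma spd_diag A i : spd A -> 0 <= A i i.
Proof.
move=> [_ /(_ (delta_mx i 0))]; rewrite -/(qform _ _) qformE.
rewrite (bigD1 i)//= (bigD1 i)//= !big1 ?addr0 => [| j ji | j ji].
- by rewrite !mxE !eqxx !mulr1.
- by apply: big1 => k _; rewrite !mxE (negPf ji) mul0r mulr0.
- by rewrite !mxE (negPf ji) !mulr0.
Qed.

Lemma spd_trace_ge0 A : spd A -> 0 <= \tr A.
Proof. by move=> pA; apply: sumr_ge0 => i _; exact: spd_diag. Qed.

Lemma qform_delta2 A i j (c : R) : A^T = A ->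
  qform A (delta_mx i 0 + c *: delta_mx j 0)
  = A i i + c ^+ 2 * A j j + 2 * c * A i j.
Proof.
move=> sA.
have sij : A j i = A i j by rewrite -{1}sA mxE.
rewrite /qform trmxD trmxZ !trmx_delta.
rewrite !(mulmxDl, mulmxDr).
rewrite -!(scalemxAl, scalemxAr).
have E k l : ((delta_mx 0 k : 'rV[R]_n) *m A *m (delta_mx l 0 : 'cV[R]_n)) 0 0
   = A k l.
  by rewrite -rowE -colE !mxE.
rewrite !mxlinE !E sij; ring.
Qed.

(** Recovering the entries from the quadratic form reduces entrywise convergence of symmetric
    matrices to convergence of real sequences. *)
Lemma polarization A i j : A^T = A ->
  A i j = (qform A (delta_mx i 0 + 1 *: delta_mx j 0)
          - qform A (delta_mx i 0 + (-1) *: delta_mx j 0)) / 4.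
Proof. by move=> sA; rewrite !qform_delta2//; field. Qed.

(** The diagonal entries are nonnegative with sum zero, so they vanish. The form at e_i + e_j and at
    e_i - e_j is then plus and minus twice the entry, and both values are nonnegative. *)
Lemma spd_trace0 A : spd A -> \tr A = 0 -> A = 0.
Proof.
move=> pA t0; have d0 i : A i i = 0.
  have /eqP := t0; rewrite /mxtrace psumr_eq0; last by move=> k _; exact: spd_diag.
  by move=> /allP/(_ i); rewrite mem_index_enum => /(_ isT)/eqP.
case: pA => sA pA; apply/matrixP => i j; rewrite mxE.
have := pA (delta_mx i 0 + 1 *: delta_mx j 0).
have := pA (delta_mx i 0 + (-1) *: delta_mx j 0).
rewrite -!/(qform _ _) !qform_delta2// !d0; lra.
Qed.

Lemma trace_mul_tr m p (X : 'M[R]_(m, p)) : \tr (X *m X^T) = \sum_i \sum_j X i j ^+ 2.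
Proof.
apply: eq_bigr => i _; rewrite mxE; apply: eq_bigr => j _.
by rewrite mxE expr2.
Qed.

Lemma mul_tr_eq0 m p (X : 'M[R]_(m, p)) : X *m X^T = 0 -> X = 0.
Proof.
move=> h; have := trace_mul_tr X; rewrite h mxtrace0 => /esym/eqP.
rewrite psumr_eq0; last by move=> i _; apply: sumr_ge0 => j _; exact: sqr_ge0.
move=> /allP h0; apply/matrixP => i j; rewrite mxE.
have := h0 i; rewrite mem_index_enum => /(_ isT) /=.
rewrite psumr_eq0; last by move=> k _; exact: sqr_ge0.
move=> /allP/(_ j); rewrite mem_index_enum => /(_ isT) /=.
by rewrite sqrf_eq0 => /eqP.
Qed.

Lemma tr_mul_eq0 m p (X : 'M[R]_(m, p)) : X^T *m X = 0 -> X = 0.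
Proof.
by move=> h; apply: trmx_inj; rewrite trmx0; apply: mul_tr_eq0; rewrite trmxK.
Qed.

Lemma sym_sqr_eq0 X : X^T = X -> X *m X = 0 -> X = 0.
Proof. by move=> sX h; apply: mul_tr_eq0; rewrite sX. Qed.

Lemma trace_tr_mul_ge0 X : 0 <= \tr (X^T *m X).
Proof. exact/spd_trace_ge0/spd_tr_mul. Qed.

Lemma trace_tr_mul_eq0 X : \tr (X^T *m X) = 0 -> X = 0.
Proof. by move=> h; apply: tr_mul_eq0; apply: spd_trace0 => //; exact: spd_tr_mul. Qed.

(* The constant 1 keeps the bound invertible. *)
Definition abs_bound A : R := 1 + \sum_i \sum_j `|A i j|.

Lemma abs_bound_gt0 A : 0 < abs_bound A.
Proof.
rewrite ltr_pwDl// sumr_ge0// => i _; rewrite sumr_ge0// => j _.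
Qed.

Lemma spd_abs_bound A : A^T = A -> spd ((abs_bound A)%:M - A).
Proof.
move=> sA; split=> [|x]; first by rewrite linearB /= tr_scalar_mx sA.
rewrite -/(qform _ _) -scalemx1 qformB qformZ subr_ge0.
set s := qform 1%:M x.
have sE : s = \sum_i x i 0 ^+ 2.
  rewrite /s /qform mulmx1 mxE; apply: eq_bigr => i _; by rewrite mxE expr2.
have s0 : 0 <= s by rewrite sE sumr_ge0// => i _; exact: sqr_ge0.
have sx i : x i 0 ^+ 2 <= s.
  rewrite sE (bigD1 i)//= lerDl sumr_ge0// => j _; exact: sqr_ge0.
(* Since 2 |x_i x_j| <= x_i^2 + x_j^2 <= 2 s, each term of the form is at most |A i j| s. *)
apply: (@le_trans _ _ ((\sum_i \sum_j `|A i j|) * s)); last first.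
  by rewrite /abs_bound mulrDl mul1r lerDr.
rewrite qformE mulr_suml; apply: ler_sum => i _.
rewrite mulr_suml; apply: ler_sum => j _.
apply: (le_trans (ler_norm _)); rewrite normrM ler_wpM2l//.
rewrite ler_norml; have := sx i; have := sx j.
have := sqr_ge0 (x i 0 + x j 0); have := sqr_ge0 (x i 0 - x j 0).
rewrite !expr2 => *; apply/andP; split; nra.
Qed.

(* [Y - Y^2 = Y(1-Y)Y + (1-Y)Y(1-Y)] *)
Lemma spd_sub_sqr Y : spd Y -> spd (1%:M - Y) -> spd (Y - Y *m Y).
Proof.
move=> pY pZ.
have -> : Y - Y *m Y = Y *m (1%:M - Y) *m Y + (1%:M - Y) *m Y *m (1%:M - Y).
  rewrite !(mulmxBl, mulmxBr, mul1mx, mulmx1) ?mulmxA.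
  by apply/matrixP => i j; rewrite !mxlinE; ring.
by apply: spdD; apply: spd_congr_sym => //; case: pY => //; case: pZ.
Qed.

Lemma sym_exp T k : T^T = T -> (T ^+ k)^T = T ^+ k.
Proof.
move=> sT; elim: k => [|k IH]; first by rewrite expr0 trmx1.
by rewrite {1}exprS -mulmxE trmx_mul sT IH mulmxE -exprSr.
Qed.

(** Induction by steps of two: T^(k+2) = T T^k T is a congruence by a symmetric matrix. *)
Lemma spd_exp T k : spd T -> spd (T ^+ k).
Proof.
move=> pT; have sT := pT.1; elim/ltn_ind: k => -[|[|k]] IH.
- by rewrite expr0; exact: spd1.
- by rewrite expr1.
- rewrite exprS exprSr mulrA -!mulmxE.
  by apply: spd_congr_sym => //; apply: IH.
Qed.

(** Congruence by [T] advances [k] by two, so the induction starts from k = 0 and k = 1; the latter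
    is [spd_sub_sqr]. *)
Lemma spd_exp_sub T k : spd T -> spd (1%:M - T) -> spd (T ^+ k - T ^+ k.+1).
Proof.
move=> pT pT1; have sT := pT.1; elim/ltn_ind: k => -[|[|k]] IH.
- by rewrite expr0 expr1.
- by rewrite expr1 expr2; exact: spd_sub_sqr.
- have -> : T ^+ k.+2 - T ^+ k.+3 = T *m (T ^+ k - T ^+ k.+1) *m T.
    by rewrite mulmxBr mulmxBl !mulmxE -!exprS -!exprSr.
  by apply: spd_congr_sym => //; apply: IH.
Qed.

End PositiveSemidefinite.

(** * Entrywise convergence of matrix sequences *)

Section EntrywiseLimits.
Context {R : realType} {n : nat}.
Implicit Types (Z Y : nat -> 'M[R]_n) (L K X : 'M[R]_n).

Lemma cvg_sumr (I : Type) (r : seq I) (F : I -> nat -> R) (l : I -> R) :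
    (forall i, (F i k @[k --> \oo]) --> l i) ->
  (\sum_(i <- r) F i k @[k --> \oo]) --> \sum_(i <- r) l i.
Proof. by move=> h; apply: cvg_big => // -[a b]; exact: add_continuous. Qed.

Definition mxcvg Z L := forall i j, (Z k i j @[k --> \oo]) --> L i j.

Lemma mxcvg_unique Z L K : mxcvg Z L -> mxcvg Z K -> L = K.
Proof.
by move=> hL hK; apply/matrixP => i j; exact: (cvg_unique _ (hL i j) (hK i j)).
Qed.

Lemma mxcvg_cst X : mxcvg (fun=> X) X.
Proof. by move=> i j; exact: cvg_cst. Qed.

Lemma mxcvg_ext Z Y L : Z =1 Y -> mxcvg Z L -> mxcvg Y L.
Proof. by move=> /funext <-. Qed.

Lemma mxcvgD Z Y L K :
  mxcvg Z L -> mxcvg Y K -> mxcvg (fun k => Z k + Y k) (L + K).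
Proof.
move=> hZ hY i j; rewrite mxE.
under eq_fun do rewrite mxE.
by apply: cvgD.
Qed.

Lemma mxcvgZ c Z L : mxcvg Z L -> mxcvg (fun k => c *: Z k) (c *: L).
Proof.
move=> hZ i j; rewrite mxE.
under eq_fun do rewrite mxE.
by apply: cvgM => //; exact: cvg_cst.
Qed.

Lemma mxcvgN Z L : mxcvg Z L -> mxcvg (fun k => - Z k) (- L).
Proof.
move=> hZ i j; rewrite mxE.
under eq_fun do rewrite mxE.
by apply: cvgN.
Qed.

Lemma mxcvgB Z Y L K :
  mxcvg Z L -> mxcvg Y K -> mxcvg (fun k => Z k - Y k) (L - K).
Proof. by move=> hZ hY; apply: mxcvgD => //; exact: mxcvgN. Qed.

Lemma mxcvgM Z Y L K :
  mxcvg Z L -> mxcvg Y K -> mxcvg (fun k => Z k *m Y k) (L *m K).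
Proof.
move=> hZ hY i j; rewrite mxE.
under eq_fun do rewrite mxE.
apply: cvg_sumr => l.
by apply: cvgM.
Qed.

Lemma mxcvg_tr Z L : mxcvg Z L -> mxcvg (fun k => (Z k)^T) L^T.
Proof.
move=> hZ i j; rewrite mxE.
under eq_fun do rewrite mxE.
exact: hZ.
Qed.

Lemma mxcvg_shift Z L : mxcvg Z L -> mxcvg (fun k => Z k.+1) L.
Proof.
move=> hZ i j.
by have := hZ i j; rewrite -(cvg_shiftS (fun k => Z k i j)).
Qed.

Lemma mxcvg_spd Z L : (forall k, spd (Z k)) -> mxcvg Z L -> spd L.
Proof.
move=> pZ hZ; split=> [|x].
  apply: mxcvg_unique (mxcvg_tr hZ) _.
  by apply: mxcvg_ext hZ => k; rewrite (pZ k).1.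
have hq : qform (Z k) x @[k --> \oo] --> qform L x.
  rewrite qformE; under eq_fun do rewrite qformE.
  apply: cvg_sumr => i; apply: cvg_sumr => j.
  by apply: cvgM => //; exact: cvg_cst.
rewrite -/(qform _ _) -(cvg_lim _ hq)//.
apply: limr_ge; first by apply/cvg_ex; exists (qform L x).
by apply: nearW => k; exact: (pZ k).2.
Qed.

(** Monotone convergence for the Loewner order: every quadratic form gives a bounded nondecreasing
    real sequence, and polarization carries convergence to the entries. *)
Lemma mxcvg_nondecreasing Z c :
    (forall k, (Z k)^T = Z k) -> (forall k, spd (Z k.+1 - Z k)) ->
    (forall k, spd (c%:M - Z k)) ->
  exists L, mxcvg Z L.
Proof.
move=> sZ incZ ubZ.
have cvgq x : cvgn (fun k => qform (Z k) x).
  apply: nondecreasing_is_cvgn.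
    apply/nondecreasing_seqP => k.
    by rewrite -subr_ge0 -qformB; exact: (incZ k).2.
  exists (qform c%:M x) => _ [k _ <-].
  by rewrite -subr_ge0 -qformB; exact: (ubZ k).2.
have cvgij i j : cvgn (fun k => Z k i j).
  under eq_fun do rewrite polarization//.
  apply: is_cvgM; last exact: is_cvg_cst.
  apply: is_cvgB; exact: cvgq.
exists (\matrix_(i, j) limn (fun k => Z k i j)) => i j; rewrite mxE.
exact: cvgij.
Qed.

End EntrywiseLimits.

(** * Existence, uniqueness and approximation of the psd square root *)

Section SquareRoot.
Context {R : realType} {n : nat}.
Implicit Types (A B M S T X Y D : 'M[R]_n).

(* A product of psd matrices need not be psd, but nonnegative polynomials in a
   single psd matrix T are psd and closed under products. *)
Inductive nnpoly T : 'M[R]_n -> Prop :=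
| nnpoly_exp k : nnpoly T (T ^+ k)
| nnpolyD X Y : nnpoly T X -> nnpoly T Y -> nnpoly T (X + Y)
| nnpolyZ c X : 0 <= c -> nnpoly T X -> nnpoly T (c *: X).

Lemma nnpoly0 T : nnpoly T 0.
Proof. by rewrite -(scale0r (T ^+ 0)); apply: nnpolyZ => //; exact: nnpoly_exp. Qed.

Lemma nnpolyM T X Y : nnpoly T X -> nnpoly T Y -> nnpoly T (X *m Y).
Proof.
move=> pX pY; elim: pX => [k|X1 X2 _ h1 _ h2|c X1 c0 _ h1].
- elim: pY => [l|Y1 Y2 _ h1 _ h2|c Y1 c0 _ h1].
  + by rewrite mulmxE -exprD; exact: nnpoly_exp.
  + by rewrite mulmxDr; exact: nnpolyD.
  + by rewrite -scalemxAr; exact: nnpolyZ.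
- by rewrite mulmxDl; exact: nnpolyD.
- by rewrite -scalemxAl; exact: nnpolyZ.
Qed.

Lemma nnpoly_spd T X : spd T -> nnpoly T X -> spd X.
Proof.
move=> pT; elim=> [k|X1 X2 _ h1 _ h2|c X1 c0 _ h1].
- exact: spd_exp.
- exact: spdD.
- exact: spdZ.
Qed.

(* The iteration for 1 - sqrt (1 - T): its fixed points Y satisfy
   (1 - Y)^2 = 1 - T. *)
Definition sqrt_iter T k : 'M[R]_n :=
  iter k (fun Y => 2^-1 *: (T + Y *m Y)) 0.

Lemma sqrt_iterS T k :
  sqrt_iter T k.+1 = 2^-1 *: (T + sqrt_iter T k *m sqrt_iter T k).
Proof. by []. Qed.

Lemma sqrt_iter_nnpoly T k : nnpoly T (sqrt_iter T k).
Proof.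
elim: k => [|k IH]; first exact: nnpoly0.
rewrite sqrt_iterS; apply: nnpolyZ; first by rewrite invr_ge0.
by apply: nnpolyD; [exact: (nnpoly_exp T 1) | exact: nnpolyM].
Qed.

(** The increments are half of X^2 - Y^2 = (X - Y) X + Y (X - Y) for consecutive iterates. The
    induction runs on nonnegative polynomials because these products need not preserve bare positive
    semidefiniteness. *)
Lemma sqrt_iter_incr_nnpoly T k :
  nnpoly T (sqrt_iter T k.+1 - sqrt_iter T k).
Proof.
elim: k => [|k IH].
  by rewrite subr0; exact: sqrt_iter_nnpoly.
rewrite [in X in nnpoly T X]sqrt_iterS [in X in - X]sqrt_iterS.
set X := sqrt_iter T k.+1 in IH *; set Y := sqrt_iter T k in IH *.
have -> : 2^-1 *: (T + X *m X) - 2^-1 *: (T + Y *m Y)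
    = 2^-1 *: ((X - Y) *m X + Y *m (X - Y)).
  rewrite mulmxBl mulmxBr.
  by apply/matrixP => i j; rewrite !mxlinE; ring.
apply: nnpolyZ; first by rewrite invr_ge0.
by apply: nnpolyD; apply: nnpolyM => //; exact: sqrt_iter_nnpoly.
Qed.

Lemma sqrt_iter_le1 T k : spd T -> spd (1%:M - T) -> spd (1%:M - sqrt_iter T k).
Proof.
move=> pT pT1; elim: k => [|k IH]; first by rewrite subr0; exact: spd1.
have pY := nnpoly_spd pT (sqrt_iter_nnpoly T k).
rewrite sqrt_iterS; set Y := sqrt_iter T k in IH pY *.
have -> : 1%:M - 2^-1 *: (T + Y *m Y)
    = 2^-1 *: ((1%:M - T) + ((1%:M - Y) + (Y - Y *m Y))).
  by apply/matrixP => i j; rewrite !mxlinE; field.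
apply: spdZ; first by rewrite invr_ge0.
by apply: spdD => //; apply: spdD => //; exact: spd_sub_sqr.
Qed.

Lemma sqrt_iter_cvg T : spd T -> spd (1%:M - T) ->
  exists L, [/\ mxcvg (sqrt_iter T) L, spd (1%:M - L)
    & (1%:M - L) *m (1%:M - L) = 1%:M - T].
Proof.
move=> pT pT1.
have [||k|L cL] := @mxcvg_nondecreasing R n (sqrt_iter T) 1.
- by move=> k; have := nnpoly_spd pT (sqrt_iter_nnpoly T k); case.
- by move=> k; apply: nnpoly_spd pT _; exact: sqrt_iter_incr_nnpoly.
- exact: sqrt_iter_le1.
exists L; split=> //.
  have cvgB := mxcvgB (@mxcvg_cst _ _ 1%:M) cL.
  by apply: mxcvg_spd cvgB => k; exact: sqrt_iter_le1.
(* Passing to the limit in the recursion gives 2 L = T + L^2, which rearranges to (1 - L)^2 = 1 -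
   T. *)
have /(mxcvg_unique (mxcvg_shift cL)) LE :
    mxcvg (fun k => sqrt_iter T k.+1) (2^-1 *: (T + L *m L)).
  by apply: mxcvgZ; apply: mxcvgD; [exact: mxcvg_cst | exact: mxcvgM].
rewrite !(mulmxBl, mulmxBr, mul1mx, mulmx1).
have : L + L = T + L *m L.
  by rewrite {1 2}LE; apply/matrixP => i j; rewrite !mxlinE; field.
move=> /matrixP h; apply/matrixP => i j; have := h i j; rewrite !mxlinE => hij.
lra.
Qed.

(** For D = A - B, D (A + B) + (A + B) D = 2 (A^2 - B^2) = 0. Multiplying by D and taking traces
    gives tr (D A D) + tr (D B D) = 0, so both psd matrices vanish. Their difference is D^3, and a
    symmetric matrix with zero cube is zero. *)
Lemma spd_sqrt_unique A B : spd A -> spd B -> A *m A = B *m B -> A = B.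
Proof.
move=> pA pB AB; have [D DE] : {D | D = A - B} by exists (A - B).
have sD : D^T = D by rewrite DE trmxD trmxN pA.1 pB.1.
have pDA : spd (D *m A *m D) by exact: spd_congr_sym.
have pDB : spd (D *m B *m D) by exact: spd_congr_sym.
have t0 : \tr (D *m A *m D) + \tr (D *m B *m D) = 0.
  have E : D *m (A + B) + (A + B) *m D = 0.
    rewrite DE !(mulmxDl, mulmxDr, mulmxN, mulNmx) AB.
    by apply/matrixP => i j; rewrite !mxlinE [RHS]mxE; ring.
  have h2 : \tr (D *m (A + B) *m D) + \tr (D *m (A + B) *m D) = 0.
    rewrite {2}mxtrace_mulC mulmxA -mxtraceD.
    rewrite -[X in _ + X]mulmxA -[X in X + _]mulmxA.
    rewrite -[X in \tr X]mulmxDr [X in D *m X]addrC.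
    by rewrite [X in D *m X](_ : _ = 0) ?mulmx0 ?mxtrace0.
  move: h2; rewrite mulmxDr mulmxDl mxtraceD => h2; lra.
have t1 := spd_trace_ge0 pDA; have t2 := spd_trace_ge0 pDB.
have A0 : D *m A *m D = 0 by apply: spd_trace0 => //; lra.
have B0 : D *m B *m D = 0 by apply: spd_trace0 => //; lra.
have D3 : D *m D *m D = 0.
  by rewrite {2}DE mulmxBr mulmxBl A0 B0 subr0.
have D2 : D *m D = 0.
  apply: sym_sqr_eq0; first by rewrite trmx_mul sD.
  by rewrite mulmxA D3 mul0mx.
by apply/eqP; rewrite -subr_eq0 -DE; apply/eqP; exact: sym_sqr_eq0.
Qed.

Lemma sqrtmx_unique M S : spd S -> S *m S = M -> sqrtmx M = S.
Proof.
move=> pS SM; rewrite /sqrtmx; case: xgetP => [B _ [pB BM]|/(_ S)]; last first.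
  by case.
by apply: spd_sqrt_unique => //; rewrite BM.
Qed.

(** Dividing by [c] puts 1 - M/c between 0 and 1, where the iteration converges; the root is then
    rescaled by the square root of [c]. The convergence is part of the conclusion for the sake of
    measurability. *)
Lemma sqrtmx_cvg M (c := abs_bound M) : spd M ->
  [/\ spd (sqrtmx M), sqrtmx M *m sqrtmx M = M
    & mxcvg (fun k => Num.sqrt c *: (1%:M - sqrt_iter (1%:M - c^-1 *: M) k))
        (sqrtmx M)].
Proof.
move=> pM; have c0 : 0 < c := abs_bound_gt0 M.
set T := 1%:M - c^-1 *: M.
have cM : 1%:M - T = c^-1 *: M by rewrite /T opprB addrC subrK.
have pT : spd T.
  have -> : T = c^-1 *: (c%:M - M).
    by rewrite scalerBr scale_scalar_mx mulVf// gt_eqF.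
  by apply: spdZ; [rewrite invr_ge0 ltW | exact: spd_abs_bound pM.1].
have [|L [cL pL LE]] := sqrt_iter_cvg pT.
  by rewrite cM; apply: spdZ => //; rewrite invr_ge0 ltW.
have pS : spd (Num.sqrt c *: (1%:M - L)) by apply: spdZ => //; exact: sqrtr_ge0.
have SE : (Num.sqrt c *: (1%:M - L)) *m (Num.sqrt c *: (1%:M - L)) = M.
  rewrite -scalemxAl -scalemxAr scalerA -expr2 sqr_sqrtr ?ltW// LE cM scalerA.
  by rewrite divff ?scale1r// gt_eqF.
rewrite (sqrtmx_unique pS SE); split=> //.
by apply: mxcvgZ; apply: mxcvgB => //; exact: mxcvg_cst.
Qed.

Lemma sqrtmx_spd M : spd M -> spd (sqrtmx M).
Proof. by case/sqrtmx_cvg. Qed.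

Lemma sqr_sqrtmx M : spd M -> sqrtmx M *m sqrtmx M = M.
Proof. by case/sqrtmx_cvg. Qed.

Lemma trace_norm_spd M : spd M -> trace_norm M = \tr M.
Proof. by move=> pM; rewrite /trace_norm (@sqrtmx_unique _ M)// pM.1. Qed.

End SquareRoot.

(** * Generalized inverses of symmetric matrices *)

Section GeneralizedInverse.
Context {R : realType} {n : nat}.
Implicit Types (M N Q T : 'M[R]_n).

(** By symmetry the row space of [M] meets its kernel trivially, so M^2 has the same rank and the
    same row space as [M]. *)
Lemma sym_factor_sqr M : M^T = M -> exists Q, M = M *m M *m Q.
Proof.
move=> sM.
have ker0 : (M :&: kermx M)%MS = 0.
  apply/eqP; rewrite -submx0; apply/rV_subP => u.
  rewrite sub_capmx => /andP[/submxP[v ->] /sub_kermxP h].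
  have /mul_tr_eq0 : v *m M *m (v *m M)^T = 0.
    by rewrite trmx_mul sM mulmxA h mul0mx.
  by move=> ->; rewrite sub0mx.
have rk : \rank (M *m M) = \rank M.
  by have := mxrank_mul_ker M M; rewrite ker0 mxrank0 addn0.
have : (M <= M *m M)%MS by rewrite -(geq_leqif (mxrank_leqif_sup (submxMl M M))) rk.
move=> /submxP[D MD]; exists D^T.
by have := congr1 trmx MD; rewrite !trmx_mul sM.
Qed.

(* Partial sums of the Neumann series for (M^2/c)^-1 (M/c). *)
Definition ginv_iter M k : 'M[R]_n :=
  let c := abs_bound (M *m M) in
  iter k (fun N => c^-1 *: M + (1%:M - c^-1 *: (M *m M)) *m N) 0.

(** For symmetric [M] this is the Moore-Penrose inverse. *)
Definition ginv M : 'M[R]_n :=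
  \matrix_(i, j) limn (fun k => ginv_iter M k i j).

Lemma ginv_iterP M k : M^T = M ->
  ginv_iter M k *m M = M *m ginv_iter M k /\ (ginv_iter M k)^T = ginv_iter M k.
Proof.
move=> sM; elim: k => [|k [cN sN]].
  by rewrite /ginv_iter /= mul0mx mulmx0 trmx0.
rewrite /ginv_iter iterS -/(ginv_iter M k) /=.
set c := abs_bound _; set N := ginv_iter M k in cN sN *; split.
  rewrite !(mulmxDl, mulmxDr, mulmxBl, mulmxBr, mul1mx, mulNmx, mulmxN).
  by rewrite -!(scalemxAl, scalemxAr) !mulmxA -cN -[_ *m N *m M]mulmxA cN !mulmxA.
rewrite !(trmxD, trmxZ, trmx_mul, trmxN, trmx1) sM sN.
rewrite !(mulmxDl, mulmxDr, mul1mx, mulmx1, mulNmx, mulmxN).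
by rewrite -!(scalemxAl, scalemxAr) !mulmxA cN -[_ *m N *m M]mulmxA cN !mulmxA.
Qed.

Lemma ginv_cvg M : M^T = M ->
  [/\ mxcvg (ginv_iter M) (ginv M), (ginv M)^T = ginv M,
      ginv M *m M = M *m ginv M & M *m ginv M *m M = M].
Proof.
move=> sM; have [Q MQ] := sym_factor_sqr sM.
have pMM : spd (M *m M) by have := spd_mul_tr M; rewrite sM.
set c := abs_bound (M *m M).
have c0 : 0 < c := abs_bound_gt0 _.
have [T TE] : {T | T = 1%:M - c^-1 *: (M *m M)} by eexists.
have T1 : 1%:M - T = c^-1 *: (M *m M) by rewrite TE opprB addrC subrK.
have pT : spd T.
  have -> : T = c^-1 *: (c%:M - M *m M).
    by rewrite TE scalerBr scale_scalar_mx mulVf// gt_eqF.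
  by apply: spdZ; [rewrite invr_ge0 ltW | exact: spd_abs_bound pMM.1].
have pT1 : spd (1%:M - T).
  by rewrite T1; apply: spdZ => //; rewrite invr_ge0 ltW.
(* As M = M^2 Q, the constant term M/c equals (1 - T) Q, and the partial sums telescope. *)
have iterE k : ginv_iter M k = (1%:M - T ^+ k) *m Q.
  elim: k => [|k IH]; first by rewrite expr0 subrr mul0mx.
  rewrite /ginv_iter iterS -/(ginv_iter M k) /= -/c -TE IH {1}MQ.
  rewrite scalemxAl -T1 exprS -mulmxE.
  rewrite !(mulmxBl, mulmxBr, mul1mx, mulmx1) ?mulmxA.
  by apply/matrixP => i j; rewrite !mxlinE; ring.
(* The powers of [T] decrease and stay above 0, so their opposites increase and stay below 0. *)
have [||k|L cL] := @mxcvg_nondecreasing R n (fun k => - T ^+ k) 0.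
- by move=> k; rewrite trmxN sym_exp// pT.1.
- by move=> k; rewrite opprK addrC; exact: spd_exp_sub.
- by rewrite raddf0 sub0r opprK; exact: spd_exp.
have {}cL : mxcvg (fun k => T ^+ k) (- L).
  by apply: mxcvg_ext (mxcvgN cL) => k; rewrite opprK.
move: cL; move: (- L) => {}L cL.
(* The limit of the powers satisfies L = L T, hence L M^2 = 0, and M = M^2 Q turns this into L M =
   0. *)
have LM0 : L *m M = 0.
  have cTL : mxcvg (fun k => T ^+ k.+1) (L *m T).
    apply: (@mxcvg_ext _ _ (fun k => T ^+ k *m T)) => [k|].
      by rewrite mulmxE -exprSr.
    by apply: mxcvgM => //; exact: mxcvg_cst.
  have LT := mxcvg_unique (mxcvg_shift cL) cTL.
  have : L *m (1%:M - T) = 0 by rewrite mulmxBr mulmx1 -LT subrr.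
  rewrite T1 -scalemxAr => /eqP; rewrite scaler_eq0 invr_eq0 gt_eqF//=.
  by move=> /eqP LMM; rewrite MQ mulmxA LMM mul0mx.
have cN : mxcvg (ginv_iter M) ((1%:M - L) *m Q).
  apply: (@mxcvg_ext _ _ (fun k => (1%:M - T ^+ k) *m Q)) => [k|].
    by rewrite iterE.
  by apply: mxcvgM; [apply: mxcvgB => // |]; exact: mxcvg_cst.
have NE : ginv M = (1%:M - L) *m Q.
  by apply/matrixP => i j; rewrite mxE; apply: cvg_lim (cN i j).
rewrite -NE in cN.
have sN : (ginv M)^T = ginv M.
  apply: mxcvg_unique (mxcvg_tr cN) _.
  by apply: mxcvg_ext cN => k; rewrite (ginv_iterP k sM).2.
have comm : ginv M *m M = M *m ginv M.
  apply: (@mxcvg_unique _ _ (fun k => ginv_iter M k *m M)).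
    by apply: mxcvgM => //; exact: mxcvg_cst.
  apply: (@mxcvg_ext _ _ (fun k => M *m ginv_iter M k)) => [k|].
    by rewrite (ginv_iterP k sM).1.
  by apply: mxcvgM => //; exact: mxcvg_cst.
have sL : L^T = L.
  apply: mxcvg_unique (mxcvg_tr cL) _.
  by apply: mxcvg_ext cL => k; rewrite sym_exp// pT.1.
have ML0 : M *m L = 0 by apply: trmx_inj; rewrite trmx_mul sL sM LM0 trmx0.
split=> //.
rewrite -mulmxA comm mulmxA NE mulmxA mulmxBr mulmx1.
by rewrite -[M *m M *m L]mulmxA ML0 mulmx0 subr0 -MQ.
Qed.

End GeneralizedInverse.

(** * The trace inequality for Green's matrices and its equality case *)

Section Alignment.
Context {R : realType} {n : nat}.
Implicit Types (A B C G H M N S V W X : 'M[R]_n).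

Lemma spd_projection E : E^T = E -> E *m E = E -> spd (1%:M - E : 'M[R]_n).
Proof.
move=> sE EE; suff -> : 1%:M - E = (1%:M - E) *m (1%:M - E)^T by exact: spd_mul_tr.
rewrite trmxD trmxN trmx1 sE mulmxBr mulmx1 mulmxBl mul1mx EE.
by rewrite subrr subr0.
Qed.

(** Take W = N X for the generalized inverse N of [H]. The matrix H N - 1 kills H^2 = X X^T, hence
    [X], so H W = X. Moreover W W^T = N H^2 N = N H is an orthogonal projection. *)
Lemma root_factor H X : H^T = H -> X *m X^T = H *m H ->
  exists2 W, X = H *m W & spd (1%:M - W *m W^T).
Proof.
move=> sH XH; have [_ sN cN HNH] := ginv_cvg sH.
set N := ginv H in sN cN HNH.
exists (N *m X).
  have : (H *m N *m X - X) *m (H *m N *m X - X)^T = 0.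
    rewrite -{2 4}[X]mul1mx -mulmxBl trmx_mul mulmxA -[_ *m X *m _]mulmxA XH.
    by rewrite mulmxA mulmxBl HNH mul1mx subrr !mul0mx.
  by move=> /mul_tr_eq0/eqP; rewrite subr_eq0 mulmxA => /eqP.
have NHN : (N *m H) *m (N *m H) = N *m H.
  have -> : N *m H *m (N *m H) = N *m (H *m N *m H) by rewrite !mulmxA.
  by rewrite HNH.
have -> : N *m X *m (N *m X)^T = N *m H.
  have -> : N *m X *m (N *m X)^T = N *m H *m (H *m N).
    by rewrite trmx_mul sN !mulmxA -[N *m X *m X^T]mulmxA XH !mulmxA.
  by rewrite -cN NHN.
by apply: spd_projection => //; rewrite trmx_mul sN sH.
Qed.

(* With C = H W, H = sqrt B, and H G = S V, where W and V are contractions,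
   C^T G = (s W)^T (s V) for s = sqrt S. So tr (C^T G) <= tr S by Cauchy-Schwarz
   for the Hilbert-Schmidt inner product, and equality forces s W = s V, which
   makes C^T G positive semidefinite. *)
Lemma trace_mul_roots B A C G (S := sqrtmx (sqrtmx B *m A *m sqrtmx B)) :
    spd B -> C *m C^T = B -> G *m G^T = A ->
  \tr (C^T *m G) <= \tr S /\ (\tr (C^T *m G) = \tr S -> spd (C^T *m G)).
Proof.
move=> pB CB GA; set H := sqrtmx B in S *.
have pH : spd H by exact: sqrtmx_spd.
have sH := pH.1.
have HGE : H *m A *m H = (H *m G) *m (H *m G)^T.
  by rewrite trmx_mul sH -GA !mulmxA.
have pHAH : spd (H *m A *m H) by rewrite HGE; exact: spd_mul_tr.
have pS : spd S by exact: sqrtmx_spd.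
have SS : (H *m G) *m (H *m G)^T = S *m S by rewrite -HGE /S sqr_sqrtmx.
clearbody S.
have [W CW pW] : exists2 W, C = H *m W & spd (1%:M - W *m W^T).
  by apply: root_factor => //; rewrite CB /H sqr_sqrtmx.
have [V GV pV] := root_factor pS.1 SS.
have ps := sqrtmx_spd pS; have ss := sqr_sqrtmx pS.
set s := sqrtmx S in ps ss.
have CG : C^T *m G = (s *m W)^T *m (s *m V).
  rewrite CW !trmx_mul ps.1 sH -mulmxA GV !mulmxA.
  by rewrite -[W^T *m s *m s]mulmxA ss.
have bound X : spd (1%:M - X *m X^T) -> \tr ((s *m X)^T *m (s *m X)) <= \tr S.
  move=> pX; rewrite mxtrace_mulC trmx_mul ps.1.
  have := spd_trace_ge0 (spd_congr_sym ps.1 pX).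
  by rewrite mulmxBr mulmxBl mulmx1 ss raddfB /= subr_ge0 !mulmxA.
have bW := bound _ pW; have bV := bound _ pV.
have E : \tr ((s *m W - s *m V)^T *m (s *m W - s *m V))
    = \tr ((s *m W)^T *m (s *m W)) + \tr ((s *m V)^T *m (s *m V))
      - 2 * \tr (C^T *m G).
  have -> : \tr (C^T *m G) = \tr ((s *m V)^T *m (s *m W)).
    by rewrite CG -mxtrace_tr trmx_mul trmxK.
  rewrite trmxD trmxN mulmxBr !mulmxBl !raddfB /=.
  have -> : \tr ((s *m W)^T *m (s *m V)) = \tr ((s *m V)^T *m (s *m W)).
    by rewrite -mxtrace_tr trmx_mul trmxK.
  ring.
have ge0 := trace_tr_mul_ge0 (s *m W - s *m V).
split=> [|eqS]; first lra.
have /trace_tr_mul_eq0/eqP : \tr ((s *m W - s *m V)^T *m (s *m W - s *m V)) = 0.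
  by apply/eqP; rewrite eq_le ge0 andbT; lra.
rewrite subr_eq0 => /eqP WV.
by rewrite CG -WV; exact: spd_tr_mul.
Qed.

(* The square root of C A C is C times the first summand; the second summand
   repairs G G^T = A without changing C G. *)
Definition aligned_root C A : 'M[R]_n :=
  let M := C *m A *m C in let N := ginv M in
  A *m C *m N *m sqrtmx M + sqrtmx (A - A *m C *m N *m M *m N *m C *m A).

(** With [a] the root of [A], the difference is a (1 - E) a, where E = a C N M N C a is an
    orthogonal projection because C a a C = M and M N M = M. *)
Lemma aligned_root_defect_spd C A
    (M := C *m A *m C) (N := ginv M) : spd C -> spd A ->
  spd (A - A *m C *m N *m M *m N *m C *m A).
Proof.
move=> pC pA; have sC := pC.1.
have ME : M = C *m A *m C by [].
have sM : M^T = M by have [] := spd_congr_sym sC pA.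
have [_ sN _ MNM] := ginv_cvg sM; rewrite -/N in sN MNM.
clearbody N; clearbody M.
have pa := sqrtmx_spd pA; have aa := sqr_sqrtmx pA; have sa := pa.1.
move: (sqrtmx A) pa aa sa => a pa aa sa.
pose E := a *m C *m N *m M *m N *m C *m a.
have -> : A - A *m C *m N *m M *m N *m C *m A = a *m (1%:M - E) *m a.
  rewrite mulmxBr mulmxBl mulmx1 aa /E !mulmxA aa.
  by rewrite -[_ *m a *m a]mulmxA aa.
apply: spd_congr_sym => //; apply: spd_projection.
  by rewrite /E !trmx_mul sa sC sN sM !mulmxA.
have EE : E *m E =
    a *m C *m (N *m M *m N *m (C *m (a *m a) *m C) *m N *m M *m N) *m C *m a.
  by rewrite /E !mulmxA.
rewrite EE aa -ME.
have -> : N *m M *m N *m M *m N *m M *m N = N *m (M *m N *m M *m N *m M) *m N.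
  by rewrite !mulmxA.
by rewrite MNM MNM /E !mulmxA.
Qed.

Lemma aligned_rootP C A : spd C -> spd A ->
  aligned_root C A *m (aligned_root C A)^T = A /\
  C *m aligned_root C A = sqrtmx (C *m A *m C).
Proof.
move=> pC pA; rewrite /aligned_root.
have pM : spd (C *m A *m C) := spd_congr_sym pC.1 pA.
have pD := aligned_root_defect_spd pC pA.
have [M ME] : {M | M = C *m A *m C} by eexists.
rewrite -ME in pM pD *.
have [[sM sC] sA] := (pM.1, pC.1, pA.1).
have [_ sN cN MNM] := ginv_cvg sM.
move: (ginv M) sN cN MNM pD => N sN cN MNM pD.
have pS := sqrtmx_spd pM; have SS := sqr_sqrtmx pM.
move: (sqrtmx M) pS SS => S pS SS; have sS := pS.1.
have pd := sqrtmx_spd pD; have dd := sqr_sqrtmx pD.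
move: (sqrtmx _) pd dd => d pd dd; have sd := pd.1.
(* Compressing the defect by [C] gives M - M N M N M = 0. Hence C d = 0, and then S d = 0 because
   S^2 = C A C, so all cross terms with [d] vanish. *)
have CDC : C *m (d *m d) *m C = 0.
  rewrite dd mulmxBr mulmxBl -ME.
  have -> : C *m (A *m C *m N *m M *m N *m C *m A) *m C
      = C *m A *m C *m N *m M *m N *m (C *m A *m C) by rewrite !mulmxA.
  by rewrite -ME MNM MNM subrr.
have Cd : C *m d = 0.
  by apply: mul_tr_eq0; rewrite trmx_mul sC sd mulmxA -[C *m d *m d]mulmxA.
have dC : d *m C = 0 by apply: trmx_inj; rewrite trmx_mul sC sd Cd trmx0.
have Sd : S *m d = 0.
  apply: tr_mul_eq0; rewrite trmx_mul sS sd mulmxA -[d *m S *m S]mulmxA SS.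
  by rewrite ME !mulmxA dC !mul0mx.
have dS : d *m S = 0 by apply: trmx_inj; rewrite trmx_mul sS sd Sd trmx0.
split.
  rewrite trmxD !trmx_mul sd sS sN sC sA mulmxDr !mulmxDl !mulmxA dS !mul0mx.
  rewrite -[_ *m S *m d]mulmxA Sd mulmx0 addr0 add0r dd.
  by rewrite -[_ *m S *m S]mulmxA SS addrC subrK.
rewrite mulmxDr Cd addr0 !mulmxA -ME.
(* The matrix M N - 1 annihilates M = S S^T, hence it annihilates [S]. *)
have : (M *m N *m S - S) *m (M *m N *m S - S)^T = 0.
  rewrite -{2 4}[S]mul1mx -mulmxBl trmx_mul mulmxA sS -[_ *m S *m S]mulmxA SS.
  by rewrite mulmxBl MNM mul1mx subrr mul0mx.
by move=> /mul_tr_eq0/eqP; rewrite subr_eq0 => /eqP.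
Qed.

End Alignment.

(** * Measurability of matrix operations, roots and aligned roots *)

Section RandomMatrixMeasurability.
Context {d : measure_display} {Omega : measurableType d} {R : realType} {n : nat}.
Implicit Types (F G M : Omega -> 'M[R]_n) (c : Omega -> R).

Lemma random_matrix_cst (X : 'M[R]_n) : random_matrix (fun _ : Omega => X).
Proof. by move=> i j; exact: measurable_cst. Qed.

Lemma random_matrixD F G :
  random_matrix F -> random_matrix G -> random_matrix (fun w => F w + G w).
Proof.
move=> mF mG i j; under eq_fun do rewrite mxE.
exact: measurable_funD.
Qed.

Lemma random_matrixM F G :
  random_matrix F -> random_matrix G -> random_matrix (fun w => F w *m G w).
Proof.
move=> mF mG i j; under eq_fun do rewrite mxE.
apply: measurable_sum => k; exact: measurable_funM.
Qed.

Lemma random_matrixZ c G : measurable_fun setT c ->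
  random_matrix G -> random_matrix (fun w => c w *: G w).
Proof.
move=> mc mG i j; under eq_fun do rewrite mxE.
exact: measurable_funM.
Qed.

Lemma random_matrixN G : random_matrix G -> random_matrix (fun w => - G w).
Proof.
move=> mG i j; under eq_fun do rewrite mxE.
exact: measurableT_comp.
Qed.

Lemma random_matrixB F G :
  random_matrix F -> random_matrix G -> random_matrix (fun w => F w - G w).
Proof. by move=> mF mG; apply: random_matrixD => //; exact: random_matrixN. Qed.

Lemma random_matrix_lim (Fk : nat -> Omega -> 'M[R]_n) F :
  (forall k, random_matrix (Fk k)) -> (forall w, mxcvg (fun k => Fk k w) (F w)) ->
  random_matrix F.
Proof.
move=> mF cF i j.
apply: (measurable_realfun.measurable_fun_cvg (h := fun k w => Fk k w i j)).
  by move=> k; exact: mF.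
by move=> w _; exact: cF.
Qed.

Lemma measurable_abs_bound M : random_matrix M ->
  measurable_fun setT (fun w => abs_bound (M w)).
Proof.
move=> mM; apply: measurable_funD; first exact: measurable_cst.
apply: measurable_sum => i; apply: measurable_sum => j.
exact: measurableT_comp.
Qed.

(** The exponents -1 and 1/2 give the two scalings that occur in the iterations. *)
Lemma measurable_powR_abs_bound M p : random_matrix M ->
  measurable_fun setT (fun w => abs_bound (M w) `^ p).
Proof.
move=> mM.
exact: (measurableT_comp (@measurable_powR R p) (measurable_abs_bound mM)).
Qed.

Lemma measurable_inv_abs_bound M : random_matrix M ->
  measurable_fun setT (fun w => (abs_bound (M w))^-1).
Proof.
move=> mM; under eq_fun do rewrite -powR_inv1 ?(ltW (abs_bound_gt0 _))//.
exact: measurable_powR_abs_bound.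
Qed.

(** Every iterate is built from [M] by sums, products and measurable scalars, and the root is their
    pointwise limit. *)
Lemma random_sqrtmx M : random_matrix M -> (forall w, spd (M w)) ->
  random_matrix (fun w => sqrtmx (M w)).
Proof.
move=> mM pM.
pose T w : 'M[R]_n := 1%:M - (abs_bound (M w))^-1 *: M w.
have mT : random_matrix T.
  apply: random_matrixB; first exact: random_matrix_cst.
  by apply: random_matrixZ => //; exact: measurable_inv_abs_bound.
apply: (@random_matrix_lim (fun k w =>
    Num.sqrt (abs_bound (M w)) *: (1%:M - sqrt_iter (T w) k))); last first.
  by move=> w; have [] := sqrtmx_cvg (pM w).
move=> k; apply: random_matrixZ.
  under eq_fun do rewrite -powR12_sqrt ?(ltW (abs_bound_gt0 _))//.
  exact: measurable_powR_abs_bound.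
apply: random_matrixB; first exact: random_matrix_cst.
elim: k => [|k IH]; first exact: random_matrix_cst.
apply: random_matrixZ; first exact: measurable_cst.
by apply: random_matrixD => //; exact: random_matrixM.
Qed.

Lemma random_ginv M : random_matrix M -> (forall w, (M w)^T = M w) ->
  random_matrix (fun w => ginv (M w)).
Proof.
move=> mM sM.
apply: (@random_matrix_lim (fun k w => ginv_iter (M w) k)); last first.
  by move=> w; have [] := ginv_cvg (sM w).
have mc : measurable_fun setT (fun w => (abs_bound (M w *m M w))^-1).
  by apply: measurable_inv_abs_bound; exact: random_matrixM.
elim=> [|k IH]; first exact: random_matrix_cst.
apply: random_matrixD; first exact: random_matrixZ.
apply: random_matrixM => //; apply: random_matrixB; first exact: random_matrix_cst.
by apply: random_matrixZ => //; exact: random_matrixM.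
Qed.

(** This provides the measurable choice of a Green's matrix that attains the trace bound. *)
Lemma random_aligned_root (C : 'M[R]_n) M : spd C ->
  random_matrix M -> (forall w, spd (M w)) ->
  random_matrix (fun w => aligned_root C (M w)).
Proof.
move=> pC mM pM; rewrite /aligned_root.
have mC := random_matrix_cst C.
have mCMC : random_matrix (fun w => C *m M w *m C).
  by do 2!apply: random_matrixM => //.
have pCMC w : spd (C *m M w *m C) := spd_congr_sym pC.1 (pM w).
have mN : random_matrix (fun w => ginv (C *m M w *m C)).
  by apply: random_ginv => // w; case: (pCMC w).
have mS := random_sqrtmx mCMC pCMC.
apply: random_matrixD; first by do 3!apply: random_matrixM => //.
apply: random_sqrtmx => [|w]; last exact: aligned_root_defect_spd.
apply: random_matrixB => //.
by do 6!apply: random_matrixM => //.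
Qed.

Lemma measurable_trace M :
  random_matrix M -> measurable_fun setT (fun w => \tr (M w)).
Proof. by move=> mM; apply: measurable_sum => i; exact: mM. Qed.

End RandomMatrixMeasurability.

(** * Expectations of Green's matrices and the barycenter cost *)

Section RandomMatrixExpectation.
Context {d : measure_display} {Omega : measurableType d} {R : realType} {n : nat}.
Context (P : probability Omega R).
Implicit Types (A G M : Omega -> 'M[R]_n) (f : Omega -> R) (B C : 'M[R]_n).

Local Notation integrableR f := (P.-integrable setT (EFin \o f)).

(** The integral equals that of |f|, which is zero only for f = 0 almost everywhere. The second half
    turns equality of means into almost sure equality. *)
Lemma ae_ge0_Rintegral f : integrableR f -> {ae P, forall w, 0 <= f w} ->
  0 <= \int[P]_w f w /\ (\int[P]_w f w = 0 -> {ae P, forall w, f w = 0}).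
Proof.
move=> intf f0.
have mf : measurable_fun setT (EFin \o f) by case/integrableP: intf.
have absE : (\int[P]_w (f w)%:E = \int[P]_w `|(f w)%:E|)%E.
  apply: ae_eq_integral => //; first exact: measurableT_comp.
  by apply: filterS f0 => w f0 _ /=; rewrite ger0_norm.
split=> [|I0].
  by rewrite /Rintegral absE fine_ge0// integral_ge0.
have /(ae_eq_integral_abs P measurableT mf) : (\int[P]_w `|(f w)%:E|)%E = 0%E.
  by rewrite -absE -[LHS]fineK ?integrable_fin_num// [fine _]I0.
by apply: filterS => w /(_ I) [].
Qed.

Definition mx_integrable G := forall i j, integrableR (fun w => G w i j).

Lemma mx_expectationE G i j : mx_expectation P G i j = \int[P]_w G w i j.
Proof. by rewrite mxE unlock. Qed.

Lemma integrable_trace_mul C G : mx_integrable G ->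
  integrableR (fun w => \tr (C *m G w)) /\
  \int[P]_w \tr (C *m G w) = \tr (C *m mx_expectation P G).
Proof.
move=> iG.
have trE (X : 'M[R]_n) : \tr (C *m X) = \sum_i \sum_j C i j * X j i.
  by apply: eq_bigr => i _; rewrite mxE.
have sumP (I : Type) (r : seq I) (F : I -> Omega -> R) :
    (forall i, integrableR (F i)) ->
    integrableR (fun w => \sum_(i <- r) F i w) /\
    \int[P]_w (\sum_(i <- r) F i w) = \sum_(i <- r) \int[P]_w F i w.
  move=> iF; elim: r => [|i r [IH1 IH2]].
    have -> : (fun w => \sum_(i <- [::]) F i w) = cst 0.
      by apply/funext => w; rewrite big_nil.
    rewrite big_nil; split; first exact: integrable0.
    by rewrite Rintegral_cst// mul0r.
  have -> : (fun w => \sum_(k <- i :: r) F k w)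
      = (fun w => F i w + \sum_(k <- r) F k w).
    by apply/funext => w; rewrite big_cons.
  split; last by rewrite RintegralD// IH2 big_cons.
  exact: (integrableD _ (iF i) IH1).
have iCG i j : integrableR (fun w => C i j * G w j i).
  exact: (integrableZl _ _ (iG j i)).
have isum i := sumP _ (index_enum 'I_n) _ (iCG i).
have [intS IS] := sumP _ (index_enum 'I_n) _ (fun i => (isum i).1).
have -> : (fun w => \tr (C *m G w)) = (fun w => \sum_i \sum_j C i j * G w j i).
  by apply/funext => w; rewrite trE.
split=> //; rewrite IS trE; apply: eq_bigr => i _.
rewrite (isum i).2; apply: eq_bigr => j _.
by rewrite RintegralZl// mx_expectationE.
Qed.

Lemma covariance_integrable_trace A : random_covariance A ->
  ('E_P[fun w => trace_norm (A w)] < +oo)%E -> integrableR (fun w => \tr (A w)).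
Proof.
move=> [mA pA]; rewrite unlock => fin.
apply/integrableP; split.
  by apply/measurable_EFinP; exact: measurable_trace.
apply: le_lt_trans fin; rewrite le_eqVlt; apply/orP; left; apply/eqP.
apply: eq_integral => w _ /=.
by rewrite ger0_norm ?trace_norm_spd//; exact: spd_trace_ge0.
Qed.

(** As tr (G G^T) is the sum of the squared entries, |G_ij| <= 1 + G_ij^2 <= 1 + tr A almost
    surely. *)
Lemma green_integrable A G :
  integrableR (fun w => \tr (A w)) -> green P A G -> mx_integrable G.
Proof.
move=> iA [mG GA] i j.
have mGij : measurable_fun setT (EFin \o (fun w => G w i j)).
  by apply/measurable_EFinP; exact: mG.
have iA1 : P.-integrable setT (fun w => `|(1 + \tr (A w))%:E|)%E.
  have i1 : P.-integrable setT (EFin \o cst 1) by exact: finite_measure_integrable_cst.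
  by apply: integrable_abse; exact: (integrableD _ i1 iA).
apply/integrableP; split=> //.
apply: (@le_lt_trans _ _ (\int[P]_w `|(1 + \tr (A w))%:E|)%E); last first.
  by rewrite -ge0_fin_numE ?integral_ge0//; exact: integrable_fin_num.
apply: ae_ge0_le_integral => //.
- exact: measurableT_comp.
- by case/integrableP: iA1.
apply: filterS GA => w GAw _ /=; rewrite lee_fin.
apply: le_trans (ler_norm _).
rewrite -GAw trace_mul_tr (bigD1 i)//= (bigD1 j)//=.
have s1 : 0 <= \sum_(k < n | k != j) G w i k ^+ 2.
  by apply: sumr_ge0 => k _; exact: sqr_ge0.
have s2 : 0 <= \sum_(k < n | k != i) \sum_l G w k l ^+ 2.
  by do 2!(apply: sumr_ge0 => ? _); exact: sqr_ge0.
have := sqr_ge0 (`|G w i j| - 1).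
rewrite sqrrB expr1n mulr1 real_normK ?num_real// => h.
have : 0 <= G w i j ^+ 2 by exact: sqr_ge0.
lra.
Qed.

Lemma aligned_root_green A C : spd C -> random_covariance A ->
  green P A (fun w => aligned_root C (A w)).
Proof.
move=> pC [mA pA]; split; first exact: random_aligned_root.
by apply: aeW => w; case: (aligned_rootP pC (pA w)).
Qed.

(** The mean g_B; for psd [B] and integrable tr A it maximizes tr (B^{1/2} E G) over the Green's
    matrices G of [A]. *)
Definition best_mean A B : 'M[R]_n :=
  mx_expectation P (fun w => aligned_root (sqrtmx B) (A w)).

Lemma trace_aligned_root A B w : random_covariance A -> spd B ->
  \tr (sqrtmx (sqrtmx B *m A w *m sqrtmx B))
  = \tr (sqrtmx B *m aligned_root (sqrtmx B) (A w)).
Proof.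
by move=> [_ pA] pB; rewrite (aligned_rootP (sqrtmx_spd pB) (pA w)).2.
Qed.

(** The aligned root makes the root term linear in a Green's matrix, so that the expectation passes
    inside the trace. *)
Lemma barycenter_costE A B : random_covariance A ->
  integrableR (fun w => \tr (A w)) -> spd B ->
  barycenter_cost P A B
  = (\tr B + \int[P]_w \tr (A w) - 2 * \tr (sqrtmx B *m best_mean A B))%:E.
Proof.
move=> cA iA pB; rewrite /barycenter_cost unlock.
have iG := green_integrable iA (aligned_root_green (sqrtmx_spd pB) cA).
have [iT <-] := integrable_trace_mul (sqrtmx B) iG.
have iB : integrableR (fun=> \tr B).
  exact: finite_measure_integrable_cst.
have iBA : integrableR (fun w => \tr B + \tr (A w)) by exact: integrableD iB iA.
have iT2 : integrableR
    (fun w => 2 * \tr (sqrtmx B *m aligned_root (sqrtmx B) (A w))).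
  exact: (integrableZl _ _ iT).
have -> : (\int[P]_w (W2sq B (A w))%:E = \int[P]_w (\tr B + \tr (A w)
    - 2 * \tr (sqrtmx B *m aligned_root (sqrtmx B) (A w)))%:E)%E.
  by apply: eq_integral => w _; rewrite /W2sq trace_aligned_root.
rewrite -[LHS]fineK; last first.
  by apply: integrable_fin_num => //; exact: (integrableB _ iBA iT2).
congr EFin; rewrite -/(Rintegral P setT _) RintegralB// RintegralZl//.
by rewrite RintegralD// Rintegral_cst// [X in fine X]probability_setT mulr1.
Qed.

(** Integrates [trace_mul_roots]: the gap is nonnegative almost surely, so a zero mean gap forces
    its equality case almost surely. *)
Lemma trace_expectation_green A B C G : random_covariance A ->
    integrableR (fun w => \tr (A w)) -> spd B -> C *m C^T = B -> green P A G ->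
  \tr (C^T *m mx_expectation P G) <= \tr (sqrtmx B *m best_mean A B) /\
  (\tr (C^T *m mx_expectation P G) = \tr (sqrtmx B *m best_mean A B) ->
   {ae P, forall w, spd (C^T *m G w)}).
Proof.
move=> cA iA pB CB gG.
have iH := green_integrable iA (aligned_root_green (sqrtmx_spd pB) cA).
have [iT TE] := integrable_trace_mul (sqrtmx B) iH.
have [iU UE] := integrable_trace_mul C^T (green_integrable iA gG).
pose D w := \tr (sqrtmx B *m aligned_root (sqrtmx B) (A w)) - \tr (C^T *m G w).
have iD : integrableR D by exact: (integrableB _ iT iU).
have DE : \int[P]_w D w
    = \tr (sqrtmx B *m best_mean A B) - \tr (C^T *m mx_expectation P G).
  by rewrite RintegralB// TE UE.
have GA := gG.2.
have [|D0 eqD] := ae_ge0_Rintegral iD.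
  apply: filterS GA => w GAw; rewrite /D subr_ge0 -trace_aligned_root//.
  by case: (trace_mul_roots pB CB GAw).
split=> [|E]; first by move: D0; rewrite DE subr_ge0.
have := eqD; rewrite DE E subrr => /(_ erefl).
apply: filterS2 GA => w GAw /eqP; rewrite subr_eq0 eq_sym => /eqP Dw.
by apply: (trace_mul_roots pB CB GAw).2; rewrite Dw trace_aligned_root.
Qed.

End RandomMatrixExpectation.

(** * Barycenters and optimal Green's matrices *)

Lemma HS_normE (R : realType) n (X : 'M[R]_n) : HS_norm X = Num.sqrt (\tr (X^T *m X)).
Proof. by rewrite /HS_norm mxtrace_mulC trace_mul_tr. Qed.

Lemma HS_norm_le (R : realType) n (X Y : 'M[R]_n) :
  (HS_norm X <= HS_norm Y) = (\tr (X^T *m X) <= \tr (Y^T *m Y)).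
Proof. by rewrite !HS_normE ler_sqrt// trace_tr_mul_ge0. Qed.

Theorem theorem4p3 (R : realType) (n : nat)
    (d : measure_display) (Omega : measurableType d) (P : probability Omega R)
    (A : Omega -> 'M[R]_n)
    (hA : random_covariance A)
    (hint : ('E_P[fun w => trace_norm (A w)] < +oo)%E) :
  [/\ forall Ahat : 'M[R]_n,
        barycenter P A Ahat <->
        exists2 G : Omega -> 'M[R]_n,
          optimal_green P A G &
          Ahat = mx_expectation P G *m (mx_expectation P G)^T,
      (~ exists G : Omega -> 'M[R]_n, optimal_green P A G) ->
        ~ exists Ahat : 'M[R]_n, barycenter P A Ahat
    & forall G : Omega -> 'M[R]_n,
        optimal_green P A G -> properly_aligned P G].
Proof.
have iA := covariance_integrable_trace hA hint.
set EA := \int[P]_w \tr (A w).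
have pXX (X : 'M[R]_n) : spd (X *m X^T) := spd_mul_tr X.
have green_best B : spd B ->
    green P A (fun w => aligned_root (sqrtmx B) (A w)).
  by move=> pB; apply: aligned_root_green => //; exact: sqrtmx_spd.
have costE B : spd B -> barycenter_cost P A B
    = (EA - \tr ((best_mean P A B)^T *m best_mean P A B)
       + \tr ((sqrtmx B - best_mean P A B)^T *m (sqrtmx B - best_mean P A B)))%:E.
  move=> pB; rewrite barycenter_costE//; congr EFin.
  have sC := (sqrtmx_spd pB).1; set C := sqrtmx B in sC *; set g := best_mean P A B.
  have -> : \tr B = \tr (C *m C) by rewrite /C sqr_sqrtmx.
  have E : \tr (g^T *m C) = \tr (C *m g).
    by rewrite -mxtrace_tr trmx_mul trmxK sC.
  rewrite trmxD trmxN sC mulmxBr !mulmxBl !raddfB /= E -/EA; ring.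
have cost_green G : green P A G ->
    (barycenter_cost P A (mx_expectation P G *m (mx_expectation P G)^T)
     <= (EA - \tr ((mx_expectation P G)^T *m mx_expectation P G))%:E)%E.
  move=> gG; rewrite barycenter_costE// lee_fin -/EA.
  (* The trace bound is used with C equal to the mean g of [G], a root of g g^T, so the cost is at
     most |g|^2 + E tr A - 2 |g|^2. *)
  have [] := trace_expectation_green hA iA (pXX (mx_expectation P G)) erefl gG.
  by rewrite [\tr (_ *m _^T)]mxtrace_mulC => + _; lra.
have cost_best B : spd B ->
    ((EA - \tr ((best_mean P A B)^T *m best_mean P A B))%:E
     <= barycenter_cost P A B)%E.
  by move=> pB; rewrite costE// lee_fin lerDl trace_tr_mul_ge0.
have bary_iff Ahat : barycenter P A Ahat <->
    spd Ahat /\ forall B, spd B -> (barycenter_cost P A Ahat <= barycenter_cost P A B)%E.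
  split=> -[pAhat hAhat]; split=> //.
    by move=> B pB; rewrite hAhat; apply: ereal_inf_lbound; exists B.
  apply/eqP; rewrite eq_le; apply/andP; split.
    by apply: le_ereal_inf_tmp => _ [B pB <-]; exact: hAhat.
  by apply: ereal_inf_lbound; exists Ahat.
have bary_opt Ahat : barycenter P A Ahat -> exists2 G : Omega -> 'M[R]_n,
    optimal_green P A G & Ahat = mx_expectation P G *m (mx_expectation P G)^T.
  move=> /bary_iff[pB hB]; have gB := green_best _ pB.
  (* Minimality of [Ahat] is tested against m m^T, with m the mean of [S]. *)
  have key S : green P A S -> \tr ((mx_expectation P S)^T *m mx_expectation P S)
      + \tr ((sqrtmx Ahat - best_mean P A Ahat)^T *m (sqrtmx Ahat - best_mean P A Ahat))
      <= \tr ((best_mean P A Ahat)^T *m best_mean P A Ahat).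
    move=> gS; have := le_trans (hB _ (pXX _)) (cost_green _ gS).
    rewrite costE// lee_fin; lra.
  (* Choosing in [key] the Green's matrix whose mean is [best_mean] cancels the two norms and leaves
     a square that is at most 0. *)
  have gE : sqrtmx Ahat = best_mean P A Ahat.
    apply/eqP; rewrite -subr_eq0; apply/eqP/trace_tr_mul_eq0/eqP.
    rewrite eq_le trace_tr_mul_ge0 andbT.
    by have := key _ gB; rewrite -/(best_mean P A Ahat); lra.
  exists (fun w => aligned_root (sqrtmx Ahat) (A w)).
    split=> // S gS; rewrite HS_norm_le; apply: (le_trans _ (key _ gS)).
    by rewrite lerDl trace_tr_mul_ge0.
  rewrite -/(best_mean P A Ahat) -gE (sqrtmx_spd pB).1 sqr_sqrtmx//.
split.
- move=> Ahat; split; first exact: bary_opt.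
  move=> [G [gG oG] ->]; apply/bary_iff; split=> // B pB.
  (* With g the mean of [G], the cost at g g^T is at most E tr A - |g|^2 <= E tr A - |g_B|^2, which
     is at most the cost at [B]. *)
  apply: le_trans (cost_green _ gG) _; apply: le_trans (cost_best _ pB).
  by rewrite lee_fin lerD2l lerN2 -HS_norm_le; apply: oG; exact: green_best.
- by move=> noG [Ahat /bary_opt[G oG _]]; apply: noG; exists G.
- move=> G [gG oG]; set g := mx_expectation P G.
  have [le1 aligned] := trace_expectation_green hA iA (pXX g) erefl gG.
  apply: aligned; apply/eqP; rewrite eq_le le1 /=.
  (* For B = g g^T, the lower bound on the cost gives 2 tr (B^{1/2} g_B) <= |g|^2 + |g_B|^2, and
     optimality bounds this by 2 |g|^2. Hence equality holds in the trace bound. *)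
  have := cost_best _ (pXX g); rewrite barycenter_costE// lee_fin -/EA.
  rewrite [\tr (g *m g^T)]mxtrace_mulC.
  have := oG _ (green_best _ (pXX g)); rewrite HS_norm_le -/g -/(best_mean _ _ _).
  lra.
Qed.
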